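(* Let $t\ge0$, let $(b_\alpha)_{\alpha\in\mathbb{N}^d}$ be real coefficients, and assume that the family $(b_\alpha H_\alpha(t,X_t))_{\alpha\in\mathbb{N}^d}$ is bounded in $L^1$. Then, for every $p>1$, the series $\sum_{\alpha\in\mathbb{N}^d}b_\alpha H_\alpha(s,X_s)$ converges absolutely in $L^p$ for all $s \ge 0$ with $s<\frac{t}{d^2e^p}$.
   Context: $X$ is a $d$-dimensional Brownian motion (started at $0$) on a complete probability space $(\Omega,\mathcal{F},P)$, and $L^p=L^p(\Omega,\mathcal{F},P)$ with norm $\|\cdot\|_p$. $\mathbb{N}$ includes $0$. $H_\alpha(t,x)=\prod_{i=1}^dH_{\alpha_i}(t,x_i)$ is the $d$-dimensional generalized Hermite polynomial, where $\exp\left(\lambda x-\tfrac12\lambda^2t\right)=\sum_{n\ge0}\frac{\lambda^n}{n!}H_n(t,x)$. Absolute convergence of $\sum_\alpha V_\alpha$ in $L^p$ means $\sum_\alpha\|V_\alpha\|_p<\infty$. *)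

(* Defs.v *)
From mathcomp Require Export all_boot all_order all_algebra.
From mathcomp Require Export all_classical all_reals all_analysis.
Set Implicit Arguments.
Unset Strict Implicit.
Unset Printing Implicit Defensive.
Import Order.TTheory GRing.Theory Num.Theory numFieldNormedType.Exports.
Local Open Scope classical_set_scope.
Local Open Scope ring_scope.

(* The generating function determines [H] uniquely, since the coefficients of
   a convergent power series in [l] are unique. *)
Definition hermite_generating (R : realType) (H : nat -> R -> R -> R) : Prop :=
  forall t x l : R,
    series (fun n : nat => l ^+ n / n`!%:R * H n t x) @ \oo -->
      expR (l * x - 2^-1 * l ^+ 2 * t).

Definition hermite_multi (R : realType) (d : nat) (H : nat -> R -> R -> R)
    (a : {ffun 'I_d -> nat}) (t : R) (x : 'rV[R]_d) : R :=
  \prod_(i < d) H (a i) t (x ord0 i).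

Definition borel_rV (R : realType) (d : nat) : set (set 'rV[R]_d) :=
  <<s [set A : set 'rV[R]_d | open A] >>.

Definition random_vector (R : realType) (disp : measure_display)
    (Omega : measurableType disp) (d : nat) (Y : Omega -> 'rV[R]_d) : Prop :=
  forall B, @borel_rV R d B -> measurable (Y @^-1` B).

(* Since some of the [B k] may be the whole space, the product rule over all
   indices includes the product rule over every subfamily. *)
Definition independent_vectors (R : realType) (disp : measure_display)
    (Omega : measurableType disp) (P : probability Omega R) (d n : nat)
    (Y : 'I_n -> Omega -> 'rV[R]_d) : Prop :=
  forall B : 'I_n -> set 'rV[R]_d, (forall k, @borel_rV R d (B k)) ->
    P (\bigcap_(k in [set: 'I_n]) (Y k @^-1` B k)) =
      (\prod_(k < n) P (Y k @^-1` B k))%E.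

(* The law of [Y] is the [d]-fold product of [N(0, v)], that is
   [N(0, v I_d)]; [normal_prob] takes the standard deviation. *)
Definition centered_gaussian_vector (R : realType) (disp : measure_display)
    (Omega : measurableType disp) (P : probability Omega R) (d : nat) (v : R)
    (Y : Omega -> 'rV[R]_d) : Prop :=
  forall B : 'I_d -> set R, (forall i, measurable (B i)) ->
    P (Y @^-1` [set x | forall i, B i (x ord0 i)]) =
      (\prod_(i < d) normal_prob 0 (Num.sqrt v) (B i))%E.

(* Only the restriction of [X] to the times [0 <= t] matters. *)
Record brownian_motion (R : realType) (disp : measure_display)
    (Omega : measurableType disp) (P : probability Omega R) (d : nat)
    (X : R -> Omega -> 'rV[R]_d) : Prop := {
  bm_measurable : forall t : R, 0 <= t -> random_vector (X t);
  bm_start : {ae P, forall w, X 0 w = 0};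
  bm_gaussian : forall s t : R, 0 <= s -> s < t ->
    centered_gaussian_vector P (t - s) (fun w => X t w - X s w);
  bm_independent : forall (n : nat) (u : nat -> R), 0 <= u 0%N ->
    (forall k, (k < n)%N -> u k < u k.+1) ->
    independent_vectors P (fun (k : 'I_n) w => X (u k.+1) w - X (u k) w);
  bm_continuous : {ae P, forall w,
    {within [set t : R | 0 <= t], continuous (fun t : R => X t w)}} }.

Definition bounded_in_Lp (R : realType) (disp : measure_display)
    (Omega : measurableType disp) (P : probability Omega R) (p : R) (I : Type)
    (V : I -> Omega -> R) : Prop :=
  (forall a, V a \in Lfun P p%:E) /\
  exists C : R, forall a, ('N[P]_p%:E[EFin \o V a] <= C%:E)%E.

Definition converges_absolutely_in_Lp (R : realType) (disp : measure_display)
    (Omega : measurableType disp) (P : probability Omega R) (p : R)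
    (I : choiceType) (V : I -> Omega -> R) : Prop :=
  (forall a, V a \in Lfun P p%:E) /\
  (\esum_(a in [set: I]) 'N[P]_p%:E[EFin \o V a] < +oo)%E.

(* Main.v *)
Require Import Defs.
From mathcomp Require Import ring lra measurable_realfun.
Import Order.TTheory GRing.Theory Num.Theory numFieldNormedType.Exports.
Local Open Scope classical_set_scope.
Local Open Scope ring_scope.
Set Implicit Arguments.
Unset Strict Implicit.
Unset Printing Implicit Defensive.

(** The coordinates of [X_t] are independent [N(0,t)] variables, so every norm
    of [H_a(t, X_t)] is a product over the coordinates ([expectation_prod]) and
    the problem is about one Gaussian variable and one polynomial [H_n]. The
    bound in L^1 gives [|b_a| <= C / prod_i ||H_{a_i}(t)||_1], hence
      [||b_a H_a(s, X_s)||_p <= C prod_i ||H_{a_i}(s)||_p / ||H_{a_i}(t)||_1],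
    and the sum over multi-indices of the right-hand side is at most [C] times
    the [d]-th power of the sum over [n] of the one-dimensional ratios. Only
    the convergence of that one series is at stake.

    Lower bound for the L^1 norm. For [Z] of law [N(0,t)], the Cameron-Martin
    formula reads [E exp(l Z - l^2 t/2) f(Z) = E f(Z + l t)]. With
    [f(x) = cos(m x + phi)] the right-hand side is an explicit trigonometric
    function of [l], and the left-hand side has the Taylor coefficients
    [E H_n(t, Z) f(Z) / n!]. The phase [phi] being chosen by the parity of [n],
    this gives [|E H_n(t, Z) f(Z)| = (m t)^n exp(- m^2 t/2)], because
    [E cos(m Z) = exp(- m^2 t/2)]. Since [|f| <= 1], this number is a lower
    bound for [E |H_n(t, Z)|] ([hermite_normal_L1_ge]); the best choice
    [m^2 = n/t] yields [(n t)^(n/2) exp(- n/2)].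

    Upper bound for the L^p norm. The coefficients of [exp(l x - l^2 s/2)] in
    powers of [l] are dominated by those of [exp(l |x| + l^2 s/2)], which are
    nonnegative, so [|H_n(s, x)| <= n! l^(-n) exp(l |x| + l^2 s/2)] for every
    [l > 0]. The [p]-th moment of the right-hand side is an exponential moment
    of a Gaussian variable ([hermite_normal_Lp_le]); the best choice is
    [l^2 = n / ((p + 1) s)].

    With these choices the ratio of the two bounds is
    [2 n! e^n n^(-n) rho^n], where [rho^2 = (p + 1) s / t], and this is at most
    [2 e (n + 1) rho^n] ([fact_expR_le]). As [p + 1 <= e^p <= d^2 e^p], the
    hypothesis on [s] forces [rho < 1], and the series converges. *)

(** * Entire power series *)

Section PowerSeries.
Context {R : realType}.
Implicit Types (c : R^nat) (x : R).

(** The factor [n + 1] brought by differentiation is absorbed by evaluating the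
    original series at twice the point: [n + 1 <= 2 ^ n.+1]. *)
Lemma entire_pseries_diffs c : (forall x, cvgn (pseries c x)) ->
  forall x, cvgn (pseries (pseries_diffs c) x).
Proof.
move=> cc x; pose y : R := `|x| + 1.
have y1 : 1 <= y by rewrite lerDr.
apply: (@is_cvg_pseries_inside _ _ y); last first.
  by rewrite [ltRHS]ger0_norm ?(le_trans _ y1)// ltrDl.
have Hn : cvgn (pseries (fun i => `|c i|) (2 * y)).
  apply: (@is_cvg_pseries_inside_norm _ _ (2 * y + 1)); first exact: cc.
  by rewrite !ger0_norm ?ltrDl//; lra.
apply: normed_cvg; rewrite /normed_series_of /=.
pose u := [sequence `|c n| * (2 * y) ^+ n]_n.
apply: (@series_le_cvg _ _ (fun n => u n.+1)).
- by [].
- by move=> n; rewrite /u /= mulr_ge0// exprn_ge0//; lra.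
- move=> n; rewrite /u /= /pseries_diffs !normrM normr_nat normrX.
  rewrite (ger0_norm (_ : 0 <= y)); last lra.
  rewrite mulrAC mulrC ler_wpM2l// exprMn; apply: ler_pM => //.
  - by rewrite exprn_ge0//; lra.
  - by rewrite -natrX ler_nat; exact/ltnW/ltn_expl.
  - by rewrite exprS ler_peMl ?exprn_ge0//; lra.
- move: Hn; rewrite -(is_cvg_series_restrict 1); rewrite /series /=.
  move=> /cvg_ex[l Hl]; apply/cvg_ex; exists l.
  move: Hl; rewrite -cvg_shiftS /=.
  by under eq_fun do rewrite big_add1.
Qed.

Lemma entire_pseries_derive c : (forall x, cvgn (pseries c x)) -> forall x,
  is_derive x (1 : R) (fun y => limn (pseries c y)) (limn (pseries (pseries_diffs c) x)).
Proof.
move=> cc x.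
have c1 := entire_pseries_diffs cc; have c2 := entire_pseries_diffs c1.
apply: (@pseries_snd_diffs _ c (`|x| + 1)) => //.
by rewrite [ltRHS]ger0_norm ?addr_ge0// ltrDl.
Qed.

Lemma pseries0 c : pseries c 0 @ \oo --> c 0%N.
Proof.
apply: cvg_near_cst; near=> n.
rewrite /pseries /series /= big_ltn; last by near: n; exists 1%N.
rewrite expr0 mulr1 big_nat_cond big1 ?addr0// => i /andP[/andP[i0 _] _].
by rewrite expr0n; case: i i0 => // i _; rewrite mulr0.
Unshelve. all: by end_near. Qed.

(** Induction on the index: the derivative of a series that vanishes
    identically is another such series, whose coefficients are shifted. *)
Lemma pseries_cst0_eq0 c : (forall x, pseries c x @ \oo --> (0 : R)) ->
  forall n, c n = 0.
Proof.
move=> H n; elim: n c H => [|n IH] c H.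
  by have /cvg_lim := @pseries0 c; rewrite (cvg_lim _ (H 0))// => <-.
have cc x : cvgn (pseries c x) by apply/cvg_ex; exists 0; exact: H.
have := IH (pseries_diffs c).
rewrite /pseries_diffs => E.
suff /E /eqP : forall x, pseries (pseries_diffs c) x @ \oo --> (0 : R).
  by rewrite mulf_eq0 pnatr_eq0/= => /eqP.
move=> x; have c1 := @entire_pseries_diffs c cc x.
suff <- : limn (pseries (pseries_diffs c) x) = 0 by [].
have D := @entire_pseries_derive c cc x.
rewrite -(@derive_val _ _ _ _ _ _ _ D).
rewrite (_ : (fun y => _) = cst 0) ?derive_cst//.
by apply/funext => y; exact: cvg_lim (H y).
Qed.

Lemma pseries_unique c c' (F : R -> R) :
  (forall x, pseries c x @ \oo --> F x) ->
  (forall x, pseries c' x @ \oo --> F x) -> c =1 c'.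
Proof.
move=> H H' n; apply/eqP; rewrite -subr_eq0; apply/eqP.
apply: (@pseries_cst0_eq0 (fun n => c n - c' n)) => x.
rewrite -(subrr (F x)).
rewrite (_ : pseries _ x = pseries c x \- pseries c' x); first exact: cvgB.
apply/funext => k; rewrite /pseries /series /= -sumrB.
by apply: eq_bigr => i _; rewrite mulrBl.
Qed.

End PowerSeries.

(** * Recurrence and growth of the Hermite polynomials *)

Section Hermite.
Context {R : realType} (H : nat -> R -> R -> R) (HH : hermite_generating H).
Implicit Types (t x l : R) (n : nat).

Lemma hermite_pseries t x l :
  pseries (fun n => H n t x / n`!%:R) l @ \oo --> expR (l * x - 2^-1 * l ^+ 2 * t).
Proof.
rewrite (_ : pseries _ l = series (fun n => l ^+ n / n`!%:R * H n t x)).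
  exact: HH.
by apply/funext => n; apply: eq_bigr => i _ /=; ring.
Qed.

Lemma hermite_exp_derive t x l :
  is_derive l (1 : R) (fun l => expR (l * x - 2^-1 * l ^+ 2 * t))
    ((x - l * t) * expR (l * x - 2^-1 * l ^+ 2 * t)).
Proof.
apply: is_derive_eq; rewrite /GRing.scale /=.
by field.
Qed.

(** The generating function [F] solves [F'(l) = (x - l t) F(l)]; comparing the
    coefficients of both sides gives the three-term recurrence. *)
Lemma hermite_coef_rec t x n :
  pseries_diffs (fun n => H n t x / n`!%:R) n =
  x * (H n t x / n`!%:R) - t * (if n is m.+1 then H m t x / m`!%:R else 0).
Proof.
move: n; set c := fun n => _.
have cl l : cvgn (pseries c l) by apply/cvg_ex; eexists; exact: hermite_pseries.
apply: (@pseries_unique _ _ _ (fun l => (x - l * t) * expR (l * x - 2^-1 * l ^+ 2 * t))) => l.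
- rewrite -(@derive_val _ _ _ _ _ _ _ (hermite_exp_derive t x l)).
  rewrite (_ : (fun l => expR _) = (fun l => limn (pseries c l))); last first.
    by apply/funext => l'; apply/esym/cvg_lim => //; exact: hermite_pseries.
  rewrite (@derive_val _ _ _ _ _ _ _ (@entire_pseries_derive _ c cl l)).
  exact: entire_pseries_diffs.
- rewrite -cvg_shiftS /=.
  rewrite (_ : (fun n => _) =
     (fun n => x * pseries c l n.+1 - l * t * pseries c l n)); last first.
    apply/funext => n; rewrite /pseries /series /= big_nat_recl//= mulr0 subr0.
    rewrite big_nat_recl// /c mulrDr -!addrA; congr (_ + _); first by ring.
    rewrite !mulr_sumr -sumrB; apply: eq_bigr => i _.
    by rewrite exprS; ring.
  rewrite mulrBl; apply: cvgB; apply: cvgMr; last exact: hermite_pseries.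
  by have := @hermite_pseries t x l; rewrite -cvg_shiftS.
Qed.

Lemma hermite0 t x : H 0%N t x = 1.
Proof.
have /cvg_lim := @hermite_pseries t x 0.
rewrite (cvg_lim _ (@pseries0 _ _))// mul0r expr0n/= mulr0 mul0r subrr expR0.
by rewrite fact0 divr1 => ->.
Qed.

Lemma hermite1 t x : H 1%N t x = x.
Proof.
by have := hermite_coef_rec t x 0; rewrite /pseries_diffs /= hermite0 !divr1
  mul1r mulr1 mulr0 subr0.
Qed.

Lemma hermiteSS t x n : H n.+2 t x = x * H n.+1 t x - n.+1%:R * t * H n t x.
Proof.
have := hermite_coef_rec t x n.+1; rewrite /pseries_diffs /= !factS !natrM.
have n0 : n`!%:R != 0 :> R by rewrite pnatr_eq0 -lt0n fact_gt0.
have n1 : n.+1%:R != 0 :> R by rewrite pnatr_eq0.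
have n2 : n.+2%:R != 0 :> R by rewrite pnatr_eq0.
move: n0 n1 n2; set f := n`!%:R; set p := n.+1%:R; set q := n.+2%:R => n0 n1 n2.
move=> /(congr1 (fun z => z * (p * f))) h.
by clearbody f p q; apply: (etrans (etrans _ h)); field; rewrite ?n0 ?n1 ?n2.
Qed.

Lemma two_step_ind (K : nat -> Prop) : K 0 -> K 1 -> (forall n, K n -> K n.+1 -> K n.+2) ->
  forall n, K n.
Proof.
move=> K0 K1 KS n; suff : K n /\ K n.+1 by case.
by elim: n => // n [? ?]; split => //; exact: KS.
Qed.

Lemma measurable_hermite n t : measurable_fun setT (H n t).
Proof.
elim/two_step_ind: n => [||n m1 m2].
- by rewrite (_ : H 0%N t = cst 1)//; apply/funext => x; rewrite hermite0.
- by rewrite (_ : H 1%N t = id)//; apply/funext => x; rewrite hermite1.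
- rewrite (_ : H n.+2 t = (fun x => x * H n.+1 t x - n.+1%:R * t * H n t x)).
    by apply: measurable_funB; apply: measurable_funM.
  by apply/funext => x; rewrite hermiteSS.
Qed.

(** In the recurrence for [H_n(- t, |x|)] all the signs are positive, so
    taking absolute values in the recurrence for [H_n(t, x)] gives a
    domination by induction. *)
Lemma hermite_le t x n : 0 <= t -> `|H n t x| <= H n (- t) `|x|.
Proof.
move=> t0; elim/two_step_ind: n => [||n m1 m2].
- by rewrite !hermite0 normr1.
- by rewrite !hermite1.
- rewrite !hermiteSS mulrN mulNr opprK.
  apply: (le_trans (ler_normB _ _)); rewrite !normrM lerD// ?ler_wpM2l//.
  by rewrite (ger0_norm t0) normr_nat ler_wpM2l// mulr_ge0.
Qed.

Lemma hermiteN_ge0 t x n : 0 <= t -> 0 <= H n (- t) `|x|.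
Proof. by move=> t0; exact: le_trans (hermite_le _ _ t0). Qed.

(** The dominating series is the one at time [- t] and point [|x|]: its terms
    are nonnegative, so its partial sums are at most its value, which the
    generating function makes explicit. This is the domination that allows
    expectation and series to be exchanged. *)
Lemma hermite_sum_le t x l n : 0 <= t -> 0 <= l ->
  \sum_(0 <= i < n) l ^+ i / i`!%:R * `|H i t x| <= expR (l * `|x| + 2^-1 * l ^+ 2 * t).
Proof.
move=> t0 l0; have := @HH (- t) `|x| l; rewrite mulrN opprK.
set s := series _ => Hs.
apply: (@le_trans _ _ (s n)).
  apply: ler_sum => i _; rewrite ler_wpM2l ?divr_ge0 ?exprn_ge0//.
  exact: hermite_le.
rewrite -(cvg_lim _ Hs)//; apply: nondecreasing_cvgn_le; last first.
  by apply/cvg_ex; eexists; exact: Hs.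
apply: nondecreasing_series => i _ _.
by rewrite mulr_ge0 ?divr_ge0 ?exprn_ge0 ?hermiteN_ge0.
Qed.

(** One term of the nonnegative dominating series is at most its sum (a
    Cauchy estimate). *)
Lemma hermite_exp_bound t x l n : 0 <= t -> 0 < l ->
  `|H n t x| <= n`!%:R / l ^+ n * expR (l * `|x| + 2^-1 * l ^+ 2 * t).
Proof.
move=> t0 l0; have := @hermite_sum_le t x l n.+1 t0 (ltW l0).
rewrite big_nat_recr//= => h.
have {h} : l ^+ n / n`!%:R * `|H n t x| <= expR (l * `|x| + 2^-1 * l ^+ 2 * t).
  apply: le_trans h; rewrite lerDr sumr_ge0// => i _.
  by rewrite mulr_ge0// divr_ge0// exprn_ge0// ltW.
have ln : 0 < l ^+ n by rewrite exprn_gt0.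
have fn : 0 < n`!%:R :> R by rewrite ltr0n fact_gt0.
rewrite -ler_pdivlMl; last by rewrite divr_gt0.
by rewrite invf_div.
Qed.

End Hermite.

(** * Integrals of functions of a random variable *)

Section WeightedPushforward.
Local Open Scope ereal_scope.
Context d1 d2 (T : measurableType d1) (U : measurableType d2) (R : realType).
Variables (mu : {measure set T -> \bar R}) (nu : {measure set U -> \bar R}).
Variables (G : T -> R) (Y : T -> U) (c : R).
Hypotheses (mG : measurable_fun setT G) (G0 : forall w, (0 <= G w)%R).
Hypotheses (mY : measurable_fun setT Y) (c0 : (0 <= c)%R).
Hypothesis GY : forall B, measurable B ->
  \int[mu]_w (G w * \1_B (Y w))%:E = c%:E * nu B.

Import HBNNSimple.

Lemma nnsfun_weighted_pushforward (h : {nnsfun U >-> R}) :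
  \int[mu]_w (G w * h (Y w))%:E = c%:E * \int[nu]_x (h x)%:E.
Proof.
rewrite integralT_nnsfun sintegralE ge0_mule_fsumr; last first.
  by move=> r; exact: nnsfun_mulemu_ge0.
transitivity (\int[mu]_w (\sum_(y \in range h)
    (y%:E * (G w * \1_(h @^-1` [set y]) (Y w))%:E))).
  apply: eq_integral => w _; rewrite fimfunE.
  under [RHS]eq_fsbigr do rewrite -EFinM mulrCA.
  by rewrite fsumEFin// mulr_fsumr.
have mGB (B : set U) : measurable B ->
    measurable_fun setT (fun w => (G w * \1_B (Y w))%:E).
  move=> mB; apply/measurable_EFinP; apply: measurable_funM => //.
  exact: measurableT_comp.
rewrite ge0_integral_fsum//.
- apply: eq_fsbigr => r /set_mem[x _ <-].
  by rewrite ge0_integralZl ?GY//; [rewrite muleCA|exact: mGB|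
    move=> w _; rewrite lee_fin mulr_ge0|rewrite lee_fin].
- by move=> y; apply: emeasurable_funM => //; exact: mGB.
- move=> y w _; rewrite -EFinM lee_fin mulrCA mulr_ge0//.
  by have := nnfun_muleindic_ge0 h y (Y w); rewrite lee_fin.
Qed.

(** If the measure [B |-> E (G ; Y in B)] is a multiple of [nu] then so are its
    integrals. With [Y] the identity this turns a density into a rule of
    integration; with [G] a function of independent variables, it replaces
    one indicator by an arbitrary function. *)
Lemma ge0_weighted_pushforward (f : U -> R) : measurable_fun setT f ->
  (forall x, (0 <= f x)%R) ->
  \int[mu]_w (G w * f (Y w))%:E = c%:E * \int[nu]_x (f x)%:E.
Proof.
move=> mf f0.
have mf' : measurable_fun setT (EFin \o f) by exact/measurable_EFinP.
pose h := nnsfun_approx measurableT mf'.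
have hf x : (h n x)%:E @[n --> \oo] --> (f x)%:E.
  by apply: (cvg_nnsfun_approx measurableT mf') => // y _; rewrite lee_fin.
have ndh x : {homo (fun n => h n x) : m n / (m <= n)%N >-> (m <= n)%R}.
  by move=> m n mn; exact/lefP/nd_nnsfun_approx.
have h1 : \int[nu]_x (h n x)%:E @[n --> \oo] --> \int[nu]_x (f x)%:E.
  rewrite (_ : \int[nu]_x (f x)%:E = \int[nu]_x limn (fun n => (h n x)%:E)).
    apply: cvg_monotone_convergence => //.
    - by move=> n; apply/measurable_EFinP.
    - by move=> n x _; rewrite lee_fin.
    - by move=> x _ m n mn; rewrite lee_fin ndh.
  by apply: eq_integral => x _; apply/esym/cvg_lim => //; exact: hf.
have h2 : \int[mu]_w (G w * h n (Y w))%:E @[n --> \oo] --> \int[mu]_w (G w * f (Y w))%:E.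
  rewrite (_ : \int[mu]_w _ = \int[mu]_w limn (fun n => (G w * h n (Y w))%:E)).
    apply: cvg_monotone_convergence => //.
    - move=> n; apply/measurable_EFinP; apply: measurable_funM => //.
      exact: measurableT_comp.
    - by move=> n w _; rewrite lee_fin mulr_ge0.
    - by move=> w _ m n mn; rewrite lee_fin ler_wpM2l// ndh.
  apply: eq_integral => w _; apply/esym/cvg_lim => //.
  by under eq_fun do rewrite EFinM; rewrite EFinM; apply: cvgeZl => //; exact: hf.
rewrite -(cvg_lim _ h2)//; apply: cvg_lim => //.
rewrite (_ : (fun n => _) = (fun n => c%:E * \int[nu]_x (h n x)%:E)).
  exact: cvgeZl.
by apply/funext => n; exact: nnsfun_weighted_pushforward.
Qed.

End WeightedPushforward.

(** * Gaussian translation and exponential moments *)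

Section GaussianIntegrals.
Context {R : realType} (sigma : R) (sigma_gt0 : 0 < sigma).
Notation mu := (@lebesgue_measure R).
Notation N := (normal_prob 0 sigma).
Notation v := (sigma ^+ 2).

Let sigma_neq0 : sigma != 0. Proof. by rewrite gt_eqF. Qed.

Lemma ge0_integral_normal (f : R -> R) : measurable_fun setT f ->
  (forall x, 0 <= f x) ->
  (\int[N]_x (f x)%:E = \int[mu]_x (normal_pdf 0 sigma x * f x)%:E)%E.
Proof.
move=> mf f0.
rewrite (@ge0_weighted_pushforward _ _ _ _ R mu N (normal_pdf 0 sigma) id 1)//.
- by rewrite mul1e.
- exact: measurable_normal_pdf.
- by move=> x; exact: normal_pdf_ge0.
- move=> B mB; rewrite mul1e /normal_prob [RHS]integral_mkcond.
  apply: eq_integral => x _; rewrite patchE indicE.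
  by case: ifP; rewrite ?mulr1 ?mulr0.
Qed.

Lemma ge0_lebesgue_translation (g : R -> R) (a : R) : continuous g ->
  (forall x, 0 <= g x) ->
  (\int[mu]_x (g x)%:E = \int[mu]_x (g (x + a))%:E)%E.
Proof.
move=> cg g0.
have dF x : is_derive x (1 : R) (fun x : R => x + a) 1.
  by apply: is_derive_eq; rewrite addr0.
have F' : (fun x : R => x + a)^`()%classic = cst 1.
  by apply/funext => x; rewrite derive1E derive_val.
rewrite (@increasing_ge0_integration_by_substitutionT _ (fun x => x + a) g)//.
- by apply: eq_integral => x _; rewrite F' /= mulr1.
- by move=> x y xy; rewrite ltrD2r.
- by rewrite F' => x; exact: cvg_cst.
- by rewrite F'; exact: is_cvg_cst.
- by rewrite F'; exact: is_cvg_cst.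
- exact: cvg_addrr_Ny.
- exact: cvg_addrr.
Qed.

(** The exponential weight is the ratio of the Gaussian densities centred at
    [l * sigma ^+ 2] and at [0]. Nonnegativity and continuity are what the
    change of variables for Lebesgue measure asks for. *)
Lemma ge0_cameron_martin (f : R -> R) (l : R) : continuous f ->
  (forall x, 0 <= f x) ->
  (\int[N]_x (f (x + l * v))%:E =
   \int[N]_x (expR (l * x - 2^-1 * l ^+ 2 * v) * f x)%:E)%E.
Proof.
move=> cf f0.
have cT (a : R) : continuous (fun x : R => x + a).
  by move=> x; apply: cvgD; [exact: cvg_id|exact: cvg_cst].
have cE : continuous (fun x : R => expR (l * x - 2^-1 * l ^+ 2 * v)).
  move=> x; apply: continuous_comp; last exact: continuous_expR.
  apply: cvgD; last exact: cvg_cst.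
  by apply: cvgMr; exact: cvg_id.
have c1 : continuous (fun x => f (x + l * v)).
  by move=> x; apply: (@continuous_comp _ _ _ (fun x => x + l * v)); [exact: cT|exact: cf].
have c2 : continuous (fun x => expR (l * x - 2^-1 * l ^+ 2 * v) * f x).
  by move=> x; apply: cvgM; [exact: cE|exact: cf].
have m1 := continuous_measurable_fun c1.
have m2 := continuous_measurable_fun c2.
rewrite ge0_integral_normal// ge0_integral_normal//; last first.
  by move=> x; rewrite mulr_ge0// expR_ge0.
pose g x := normal_pdf 0 sigma (x - l * v) * f x.
transitivity (\int[mu]_x (g (x + l * v))%:E)%E.
  by apply: eq_integral => x _; rewrite /g addrK.
rewrite -(@ge0_lebesgue_translation g).
- apply: eq_integral => x _; rewrite /g (mulrA (normal_pdf _ _ _)); congr (_ * _)%:E.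
  rewrite !normal_pdfE// -[RHS]mulrA; congr (_ * _).
  rewrite /normal_fun -expRD; congr expR.
  by field.
- move=> x; apply: cvgM; last exact: cf.
  apply: (@continuous_comp _ _ _ (fun x => x - l * v)); first exact: cT.
  exact: continuous_normal_pdf.
- by move=> x; rewrite mulr_ge0 ?normal_pdf_ge0.
Qed.

(** The case [f = 1] of the Cameron-Martin formula. *)
Lemma normal_mgf (l : R) : (\int[N]_x (expR (l * x))%:E = (expR (2^-1 * l ^+ 2 * v))%:E)%E.
Proof.
have := @ge0_cameron_martin (cst 1) l (@cst_continuous _ _ _) (fun=> ler01).
have -> : (\int[N]_x (cst 1 (x + l * v))%:E = 1)%E.
  transitivity (\int[N]_x cst 1%E x)%E => //.
  by rewrite integral_cst// mul1e; exact: probability_setT.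
under eq_integral do rewrite /= mulr1 expRD mulrC EFinM.
rewrite ge0_integralZl//; last first.
  by apply/measurable_EFinP; apply: measurableT_comp.
move: (integral _ _ _) => I h.
have -> : expR (2^-1 * l ^+ 2 * v) = (expR (- (2^-1 * l ^+ 2 * v)))^-1.
  by rewrite expRN invrK.
move: h (expR_gt0 (- (2^-1 * l ^+ 2 * v))); move: (expR _) => a h a0.
by rewrite -[LHS]mul1e -(mulVf (lt0r_neq0 a0)) EFinM -muleA -h mule1.
Qed.

Lemma normal_exp_abs_le (l : R) :
  (\int[N]_x (expR (l * `|x|))%:E <= (2 * expR (2^-1 * l ^+ 2 * v))%:E)%E.
Proof.
have mE (a : R) : measurable_fun setT (fun x : R => (expR (a * x))%:E).
  by apply/measurable_EFinP; apply: measurableT_comp.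
apply: (@le_trans _ _ (\int[N]_x ((expR (l * x))%:E + (expR (- l * x))%:E))%E).
  apply: ge0_le_integral => //.
  - apply/measurable_EFinP; apply: measurableT_comp => //.
    exact: measurable_funM.
  - by apply: emeasurable_funD; exact: mE.
  - move=> x _; rewrite -EFinD lee_fin; case: (ger0P x) => _.
      by rewrite lerDl expR_ge0.
    by rewrite mulrN -mulNr lerDr expR_ge0.
rewrite ge0_integralD//; [|exact: mE|exact: mE].
by rewrite !normal_mgf sqrrN -EFinD lee_fin; lra.
Qed.

End GaussianIntegrals.

(** * Norms of Hermite polynomials of a Gaussian variable *)

Section HermiteGaussian.
Context {R : realType} (H : nat -> R -> R -> R) (HH : hermite_generating H).
Context (sigma : R) (sigma_gt0 : 0 < sigma).
Notation N := (normal_prob 0 sigma).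
Notation v := (sigma ^+ 2).

Let v_ge0 : 0 <= v. Proof. exact: sqr_ge0. Qed.

Lemma normal_integrable_exp_abs (a b : R) :
  N.-integrable setT (EFin \o (fun x => expR (a * `|x| + b))).
Proof.
apply/integrableP; split.
  apply/measurable_EFinP; apply: measurableT_comp => //.
  by apply: measurable_funD => //; apply: measurable_funM.
under eq_integral do rewrite /= ger0_norm ?expR_ge0// expRD mulrC EFinM.
rewrite ge0_integralZl//; last first.
  by apply/measurable_EFinP; apply: measurableT_comp => //; exact: measurable_funM.
apply: (@le_lt_trans _ _ ((expR b)%:E * (2 * expR (2^-1 * a ^+ 2 * v))%:E)%E); last exact: ltry.
by apply: lee_wpmul2l; [rewrite lee_fin expR_ge0|exact: normal_exp_abs_le].
Qed.

Lemma normal_integrable_bounded (f : R -> R) : measurable_fun setT f ->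
  (forall x, `|f x| <= 1) -> N.-integrable setT (EFin \o f).
Proof.
move=> mf f1; apply: (le_integrable _ _ _ (normal_integrable_exp_abs 0 0)) => //.
  exact/measurable_EFinP.
by move=> x _ /=; rewrite mul0r addr0 expR0 normr1 lee_fin.
Qed.

Lemma normal_integrable_hermiteM (f : R -> R) n : measurable_fun setT f ->
  (forall x, `|f x| <= 1) -> N.-integrable setT (EFin \o (fun x => H n v x * f x)).
Proof.
move=> mf f1.
have := @integrableZl _ _ _ N _ measurableT (n`!%:R) _ (normal_integrable_exp_abs 1 (2^-1 * 1 ^+ 2 * v)).
apply: le_integrable => //.
  by apply/measurable_EFinP; apply: measurable_funM => //; exact: measurable_hermite.
move=> x _ /=; rewrite lee_fin normrM.
apply: (@le_trans _ _ `|H n v x|); first by rewrite ler_piMr.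
rewrite [leRHS]ger0_norm ?mulr_ge0 ?expR_ge0//.
by have := @hermite_exp_bound _ _ HH v x 1 n v_ge0 ltr01; rewrite [X in _ / X]expr1n divr1.
Qed.

(** The tested Hermite moments are the Taylor coefficients of the exponential
    transform of [f]: dominated convergence applied to the generating
    function. *)
Lemma hermite_gaussian_pseries (f : R -> R) l : measurable_fun setT f ->
  (forall x, `|f x| <= 1) ->
  pseries (fun n => (\int[N]_x (H n v x * f x)) / n`!%:R) l @ \oo -->
    \int[N]_x (expR (l * x - 2^-1 * l ^+ 2 * v) * f x).
Proof.
move=> mf f1.
pose S n x := \sum_(0 <= i < n) l ^+ i / i`!%:R * H i v x.
have mS n : measurable_fun setT (fun x => (S n x * f x)%:E).
  apply/measurable_EFinP; apply: measurable_funM => //.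
  apply: measurable_sum => i; apply: measurable_funM => //.
  exact: measurable_hermite.
have mE : measurable_fun setT (fun x => (expR (l * x - 2^-1 * l ^+ 2 * v) * f x)%:E).
  apply/measurable_EFinP; apply: measurable_funM => //.
  apply: measurableT_comp => //; exact: measurable_funB.
have cS x : (S n x * f x)%:E @[n --> \oo] -->
    (expR (l * x - 2^-1 * l ^+ 2 * v) * f x)%:E.
  by apply: cvg_EFin; [exact: nearW|apply: cvgMl; exact: HH].
have Sb n x : (`|(S n x * f x)%:E| <= (expR (`|l| * `|x| + 2^-1 * `|l| ^+ 2 * v))%:E)%E.
  rewrite lee_fin normrM; apply: (@le_trans _ _ `|S n x|); first by rewrite ler_piMr.
  apply: le_trans (hermite_sum_le HH x n v_ge0 (normr_ge0 l)).
  apply: (le_trans (ler_norm_sum _ _ _)); apply: ler_sum => i _.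
  by rewrite !normrM normrX normfV normr_nat.
have [//| |intE _] := @dominated_convergence _ _ _ N setT measurableT
  (fun n x => (S n x * f x)%:E) _ _ mS mE _
  (normal_integrable_exp_abs `|l| (2^-1 * `|l| ^+ 2 * v)).
- by apply: aeW => x _; exact: cS.
- by apply: aeW => x n _; exact: Sb.
rewrite -(fineK (integrable_fin_num measurableT intE)).
move=> h; have {h} : (fun n => fine (\int[N]_x (S n x * f x)%:E)%E) @ \oo -->
  \int[N]_x (expR (l * x - 2^-1 * l ^+ 2 * v) * f x) by exact: fine_cvg h.
rewrite (_ : (fun n => fine _) =
  pseries (fun n => (\int[N]_x (H n v x * f x)) / n`!%:R) l)//.
apply/funext => n /=.
transitivity (fine (\int[N]_x (\sum_(0 <= i < n) ((l ^+ i / i`!%:R)%:E * (H i v x * f x)%:E)))%E).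
  congr fine; apply: eq_integral => x _; rewrite /S mulr_suml sumEFin.
  by congr EFin; apply: eq_bigr => i _; rewrite mulrA.
rewrite integral_sum//; last first.
  by move=> i; apply: integrableZl => //; exact: normal_integrable_hermiteM.
rewrite /pseries /series /= -sum_fine; last first.
  move=> i _; apply: integrable_fin_num => //.
  by apply: integrableZl => //; exact: normal_integrable_hermiteM.
apply: eq_bigr => i _; rewrite integralZl//; last exact: normal_integrable_hermiteM.
rewrite fineM//; last first.
  by apply: integrable_fin_num => //; exact: normal_integrable_hermiteM.
by rewrite /= /Rintegral; ring.
Qed.

(** Bounded signed functions follow from nonnegative ones by adding the
    constant [1]. *)
Lemma bounded_cameron_martin (f : R -> R) l : continuous f ->
  (forall x, `|f x| <= 1) ->
  \int[N]_x (expR (l * x - 2^-1 * l ^+ 2 * v) * f x) = \int[N]_x f (x + l * v).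
Proof.
move=> cf f1.
have mf := continuous_measurable_fun cf.
have mT : measurable_fun setT (fun x : R => x + l * v) by exact: measurable_funD.
have mfT : measurable_fun setT (fun x : R => f (x + l * v)) by exact: measurableT_comp.
have mE : measurable_fun setT (fun x : R => expR (l * x - 2^-1 * l ^+ 2 * v)).
  by apply: measurableT_comp => //; exact: measurable_funB.
have intE (g : R -> R) : measurable_fun setT g -> (forall x, `|g x| <= 1) ->
    N.-integrable setT (EFin \o (fun x => expR (l * x - 2^-1 * l ^+ 2 * v) * g x)).
  move=> mg g1; apply: (le_integrable _ _ _ (normal_integrable_exp_abs `|l| 0)) => //.
    by apply/measurable_EFinP; exact: measurable_funM.
  move=> x _ /=; rewrite lee_fin normrM (ger0_norm (expR_ge0 _)) [leRHS]ger0_norm ?expR_ge0//.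
  apply: (@le_trans _ _ (expR (l * x - 2^-1 * l ^+ 2 * v))).
    by rewrite ler_piMr ?expR_ge0.
  rewrite ler_expR addr0; apply: (@le_trans _ _ (l * x)).
    by rewrite gerBl; apply: mulr_ge0 => //; rewrite mulr_ge0 ?sqr_ge0 ?invr_ge0.
  by rewrite -normrM ler_norm.
have CM (g : R -> R) : continuous g -> (forall x, 0 <= g x) ->
    \int[N]_x (expR (l * x - 2^-1 * l ^+ 2 * v) * g x) = \int[N]_x g (x + l * v).
  by move=> cg g0; rewrite /Rintegral -(ge0_cameron_martin sigma_gt0).
have c1 : continuous (fun x => 1 + f x).
  by move=> x; apply: cvgD; [exact: cvg_cst|exact: cf].
have f1' x : 0 <= 1 + f x by have := f1 x; rewrite ler_norml; lra.
have := CM _ c1 f1'.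
have cst1 x : `|cst 1 x| <= 1 :> R by rewrite normr1.
have -> : \int[N]_x (1 + f (x + l * v)) = \int[N]_x (cst 1 (x + l * v)) + \int[N]_x f (x + l * v).
  rewrite RintegralD//; last exact: normal_integrable_bounded.
  exact: (@normal_integrable_bounded (cst 1)).
rewrite -(CM (cst 1) (@cst_continuous _ _ _)) ?ler01//.
under eq_Rintegral do rewrite mulrDr.
rewrite RintegralD//; [|exact: (intE (cst 1))|exact: intE].
by move/addrI.
Qed.

Local Notation Acos lam phi := (\int[N]_x cos (lam * x + phi)).
Local Notation Asin lam phi := (\int[N]_x sin (lam * x + phi)).

Let affine_continuous (a b : R) : continuous (fun x : R => a * x + b).
Proof. by move=> x; apply: cvgD; [apply: cvgMr; exact: cvg_id|exact: cvg_cst]. Qed.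

Let cos_affine_continuous (a b : R) : continuous (fun x : R => cos (a * x + b)).
Proof.
by move=> x; apply: continuous_comp; [exact: affine_continuous|exact: continuous_cos].
Qed.

Let sin_affine_continuous (a b : R) : continuous (fun x : R => sin (a * x + b)).
Proof.
by move=> x; apply: continuous_comp; [exact: affine_continuous|exact: continuous_sin].
Qed.

Let cos_affine_integrable (a b : R) : N.-integrable setT (EFin \o (fun x : R => cos (a * x + b))).
Proof.
apply: normal_integrable_bounded; last by move=> x; exact: cos_max.
exact: continuous_measurable_fun (@cos_affine_continuous a b).
Qed.

Let sin_affine_integrable (a b : R) : N.-integrable setT (EFin \o (fun x : R => sin (a * x + b))).
Proof.
apply: normal_integrable_bounded; last by move=> x; exact: sin_max.
exact: continuous_measurable_fun (@sin_affine_continuous a b).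
Qed.

(** By translation the exponential transform of [cos (lam * x + phi)] is
    [cos (w l) * Acos - sin (w l) * Asin] with [w = lam * v]; its power series
    in [l] is read off from those of cosine and sine. *)
Lemma hermite_cos_coef (lam phi : R) n :
  \int[N]_x (H n v x * cos (lam * x + phi)) =
  (lam * v) ^+ n * ((~~ odd n)%:R * (-1) ^+ n./2 * Acos lam phi -
                    (odd n)%:R * (-1) ^+ n.-1./2 * Asin lam phi).
Proof.
set w := lam * v.
have mc := continuous_measurable_fun (@cos_affine_continuous lam phi).
have bc x : `|cos (lam * x + phi)| <= 1 by exact: cos_max.
pose c n := w ^+ n * ((~~ odd n)%:R * (-1) ^+ n./2 * Acos lam phi -
                    (odd n)%:R * (-1) ^+ n.-1./2 * Asin lam phi) / n`!%:R.
suff : (fun n => (\int[N]_x (H n v x * cos (lam * x + phi))) / n`!%:R) =1 c.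
  move=> /(_ n); rewrite /c => /(congr1 ( *%R^~ n`!%:R)).
  by rewrite !divfK// pnatr_eq0 -lt0n fact_gt0.
apply: (@pseries_unique _ _ _
  (fun l => \int[N]_x (expR (l * x - 2^-1 * l ^+ 2 * v) * cos (lam * x + phi)))) => l.
  exact: (hermite_gaussian_pseries mc bc).
rewrite (@bounded_cameron_martin (fun x => cos (lam * x + phi)))//.
have -> : \int[N]_x cos (lam * (x + l * v) + phi) =
    cos (w * l) * Acos lam phi - sin (w * l) * Asin lam phi.
  rewrite -!RintegralZl// -RintegralB//; last 2 first.
  - have := @integrableZl _ _ _ N _ measurableT (cos (w * l)) _ (cos_affine_integrable lam phi).
    exact.
  - have := @integrableZl _ _ _ N _ measurableT (sin (w * l)) _ (sin_affine_integrable lam phi).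
    exact.
  apply: eq_Rintegral => x _.
  rewrite (_ : lam * (x + l * v) + phi = lam * x + phi + w * l); last by rewrite /w; ring.
  by rewrite cosD; ring.
rewrite (_ : pseries c l = (fun n => series (cos_coeff (w * l)) n * Acos lam phi -
    series (sin_coeff (w * l)) n * Asin lam phi)).
  have hc : series (cos_coeff (w * l)) @ \oo --> cos (w * l).
    by rewrite unlock; apply: is_cvg_series_cos_coeff.
  have hs : series (sin_coeff (w * l)) @ \oo --> sin (w * l).
    by rewrite unlock; apply: is_cvg_series_sin_coeff.
  by apply: cvgB; apply: cvgMl.
apply/funext => k; rewrite /pseries /series /= !mulr_suml -sumrB.
apply: eq_bigr => i _; rewrite /c /cos_coeff /sin_coeff /=.
(* [cos_coeff] takes an integer power of [-1] *)
rewrite (exprMn _ w l) (_ : (-1) ^ i./2 = (-1) ^+ i./2)//.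
by ring.
Qed.

Let Asin_quarter (lam : R) : Asin lam (- (pi / 2)) = - Acos lam 0.
Proof.
rewrite -[RHS]mulN1r -RintegralZl//.
by apply: eq_Rintegral => x _; rewrite sinBpihalf addr0 mulN1r.
Qed.

(** The case [n = 1]: Gaussian integration by parts, since [H_1(t, x) = x]. *)
Let gauss_mulx_sin (lam : R) : \int[N]_x (- sin (lam * x) * x) = - (lam * v * Acos lam 0).
Proof.
have := hermite_cos_coef lam (- (pi / 2)) 1.
rewrite /= mul0r mul0r sub0r expr1 mul1r expr0 mul1r Asin_quarter opprK => <-.
rewrite -[RHS]mulN1r -RintegralZl//; last first.
  apply: normal_integrable_hermiteM; last by move=> x; exact: cos_max.
  exact: continuous_measurable_fun (@cos_affine_continuous _ _).
apply: eq_Rintegral => x _; rewrite cosBpihalf (hermite1 HH).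
by ring.
Qed.

Let cos_derive (x a : R) : is_derive a (1 : R) (fun a : R => cos (a * x)) (- sin (a * x) * x).
Proof. by apply: is_derive_eq; rewrite /GRing.scale /=; ring. Qed.

(** Differentiating under the integral produces [- E (Z sin (a Z))], which
    integration by parts turns back into [E cos (a Z)]. *)
Lemma normal_charfun_derive (a : R) :
  is_derive a (1 : R) (fun a => \int[N]_x cos (a * x)) (- (a * v * \int[N]_x cos (a * x))).
Proof.
have ia : `]a - 1, a + 1[%classic a by rewrite /= in_itv /=; apply/andP; split; lra.
have int_cos b : N.-integrable setT (EFin \o (fun x => cos (b * x))).
  have := cos_affine_integrable b 0.
  by under [X in EFin \o X]eq_fun do rewrite addr0.
have int_abs : N.-integrable setT (EFin \o (fun x : R => `|x|)).
  apply: (le_integrable _ _ _ (normal_integrable_exp_abs 1 0)) => //.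
    by apply/measurable_EFinP; exact: measurableT_comp.
  move=> x _ /=; rewrite lee_fin normr_id mul1r addr0 [leRHS]ger0_norm ?expR_ge0//.
  by apply: le_trans (expR_ge1Dx _); rewrite lerDr.
have der (b x : R) : derivable (fun b : R => cos (b * x)) b 1.
  by have [] := cos_derive x b.
have partE (b x : R) : partial1of2 (fun b x : R => cos (b * x)) b x = - sin (b * x) * x.
  by rewrite partial1of2E; have [_ ->] := cos_derive x b.
have bnd (b y : R) : `]a - 1, a + 1[%classic b -> [set: R] y ->
    `|partial1of2 (fun b x : R => cos (b * x)) b y| <= `|y|.
  by move=> _ _; rewrite partE normrM normrN ler_piMl// sin_max.
have D1 := @derivable_under_integral _ _ _ N (fun b x : R => cos (b * x)) setT measurableT
   a (a - 1) (a + 1) ia (fun b _ => int_cos b) (fun b x _ _ => der b x) _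
   (@normr_ge0 _ _) int_abs bnd.
have D2 := @differentiation_under_integral _ _ _ N (fun b x : R => cos (b * x)) setT measurableT
   a (a - 1) (a + 1) ia (fun b _ => int_cos b) (fun b x _ _ => der b x) _
   (@normr_ge0 _ _) int_abs bnd.
apply: DeriveDef => //; rewrite -derive1E D2.
rewrite (_ : \int[N]_x cos (a * x) = Acos a 0); last first.
  by apply: eq_Rintegral => x _; rewrite addr0.
by rewrite -gauss_mulx_sin; apply: eq_Rintegral => x _; exact: partE.
Qed.

(** The function times [exp(a^2 v/2)] has derivative zero. *)
Lemma normal_charfun (a : R) : \int[N]_x cos (a * x) = expR (- (2^-1 * a ^+ 2 * v)).
Proof.
pose g (a : R) := \int[N]_x cos (a * x).
have dg b : is_derive b (1 : R) (fun b => g b * expR (2^-1 * b ^+ 2 * v)) 0.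
  have := normal_charfun_derive b; rewrite -/g => dgb.
  apply: is_derive_eq; rewrite /GRing.scale /= -/(g b).
  by move: (g b) (expR _) => gb e; field.
have := is_derive_0_is_cst a 0 dg.
rewrite /= expr0n /= mulr0 mul0r expR0 mulr1 (_ : g 0 = 1); last first.
  rewrite /g; under eq_Rintegral do rewrite mul0r cos0.
  rewrite Rintegral_cst// [X in fine X](_ : _ = 1%E) ?mulr1//.
  exact: probability_setT.
have e0 : expR (2^-1 * a ^+ 2 * v) != 0 by rewrite gt_eqF ?expR_gt0.
by rewrite expRN => h; apply: (mulIf e0); rewrite mulVf.
Qed.

(** Duality with the bounded function [cos (a * x + phi)]. For even [n] the
    phase [0] leaves the term in [Acos]; for odd [n] the phase [- pi / 2]
    turns the remaining term in [Asin] into the same number up to sign. *)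
Lemma hermite_normal_L1_ge (a : R) n : 0 <= a ->
  (((a * v) ^+ n * expR (- (2^-1 * a ^+ 2 * v)))%:E <= \int[N]_x `|H n v x|%:E)%E.
Proof.
move=> a0; pose phi : R := if odd n then - (pi / 2) else 0.
have Acos0 : Acos a 0 = expR (- (2^-1 * a ^+ 2 * v)).
  by rewrite -normal_charfun; apply: eq_Rintegral => x _; rewrite addr0.
have mc := continuous_measurable_fun (@cos_affine_continuous a phi).
have int_n : N.-integrable setT (EFin \o (fun x => H n v x * cos (a * x + phi))).
  by apply: normal_integrable_hermiteM => // x; exact: cos_max.
have -> : (a * v) ^+ n * expR (- (2^-1 * a ^+ 2 * v)) =
    `|\int[N]_x (H n v x * cos (a * x + phi))|.
  rewrite hermite_cos_coef /phi; case: (odd n) => /=.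
    rewrite mul0r mul0r sub0r mul1r Asin_quarter Acos0.
    rewrite !(normrM, normrN, normrX) normr1 expr1n mul1r.
    by rewrite (ger0_norm a0) (ger0_norm (ltW sigma_gt0)) ger0_norm ?expR_ge0.
  rewrite mul0r mul0r subr0 mul1r Acos0.
  rewrite !(normrM, normrN, normrX) normr1 expr1n mul1r.
  by rewrite (ger0_norm a0) (ger0_norm (ltW sigma_gt0)) ger0_norm ?expR_ge0.
rewrite EFin_normr_Rintegral//; apply: (le_trans (le_abse_integral _ _ _)) => //.
  exact: measurable_int int_n.
apply: ge0_le_integral => //.
- by apply: measurableT_comp => //; exact: measurable_int int_n.
- apply/measurable_EFinP; apply: measurableT_comp => //.
  exact: measurable_hermite.
- by move=> x _; rewrite lee_fin normrM ler_piMr// cos_max.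
Qed.

(** Raised to the power [p], the pointwise exponential bound is again an
    exponential of [|x|], up to a constant. *)
Lemma hermite_normal_Lp_le (p a : R) n : 0 < p -> 0 < a ->
  (\int[N]_x (`|H n v x| `^ p)%:E <=
   (2 * (n`!%:R / a ^+ n * expR (2^-1 * a ^+ 2 * v)) `^ p *
    expR (2^-1 * (p * a) ^+ 2 * v))%:E)%E.
Proof.
move=> p0 a0; set C := n`!%:R / a ^+ n * expR (2^-1 * a ^+ 2 * v).
have C0 : 0 <= C by rewrite mulr_ge0 ?expR_ge0// divr_ge0// exprn_ge0// ltW.
have mH : measurable_fun setT (fun x => (`|H n v x| `^ p)%:E).
  apply/measurable_EFinP; apply: (measurableT_comp (measurable_powR p)).
  by apply: measurableT_comp => //; exact: measurable_hermite.
have mE : measurable_fun setT (fun x : R => (expR (p * a * `|x|))%:E).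
  apply/measurable_EFinP; apply: measurableT_comp => //.
  by apply: measurable_funM => //; apply: measurable_funM.
apply: (@le_trans _ _ (\int[N]_x ((C `^ p)%:E * (expR (p * a * `|x|))%:E))%E).
  apply: ge0_le_integral => //.
    by apply: emeasurable_funM => //; exact: measurable_cst.
  move=> x _; rewrite -EFinM lee_fin.
  rewrite -mulrA [p * _]mulrC expRM -powRM ?expR_ge0//.
  apply: ge0_ler_powR; rewrite ?nnegrE//; first exact: ltW.
    by apply: mulr_ge0 => //; exact: expR_ge0.
  apply: le_trans (hermite_exp_bound HH x n v_ge0 a0) _.
  by rewrite expRD (mulrC (expR (a * _))) mulrA.
rewrite ge0_integralZl//; last by rewrite lee_fin powR_ge0.
rewrite (_ : (2 * C `^ p * _)%:E =
    ((C `^ p)%:E * (2 * expR (2^-1 * (p * a) ^+ 2 * v))%:E)%E); last first.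
  by rewrite -EFinM; congr EFin; ring.
by apply: lee_wpmul2l; [rewrite lee_fin powR_ge0|exact: normal_exp_abs_le].
Qed.

End HermiteGaussian.

(** * Expectation of a product of independent variables *)

Section ProductExpectation.
Context d0 (T : measurableType d0) (R : realType) (P : {measure set T -> \bar R}).
Context (d : nat) (Y : 'I_d -> T -> R) (nu : probability (g_sigma_algebraType R.-ocitv.-measurable) R).
Hypothesis mY : forall i, measurable_fun setT (Y i).
Hypothesis law : forall B : 'I_d -> set R, (forall i, measurable (B i)) ->
  P [set w | forall i, B i (Y i w)] = (\prod_(i < d) nu (B i))%E.

(** For indicators this is the law of [Y] on boxes. *)
Lemma expectation_prod_indic (B : 'I_d -> set R) (m : 'I_d -> R) :
  (forall i, measurable (B i)) -> (forall i, nu (B i) = (m i)%:E) ->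
  (\int[P]_w (\prod_(i < d) \1_(B i) (Y i w))%:E = (\prod_(i < d) m i)%:E)%E.
Proof.
move=> mB Bm.
transitivity (\int[P]_w (\1_[set w | forall i, B i (Y i w)] w)%:E)%E.
  apply: eq_integral => w _; congr EFin; rewrite [RHS]indicE.
  case: (boolP (w \in _)) => [/set_mem /= h|/negP h].
    by rewrite big1// => i _; rewrite indicE mem_set.
  apply/eqP/prodf_eq0; apply: contrapT => h2; apply: h; apply/mem_set => /= i.
  apply: contrapT => Bi; apply: h2; exists i => //.
  by rewrite indicE memNset.
rewrite integral_indic//; last first.
  rewrite (_ : [set w | _] = \bigcap_(i in [set: 'I_d]) (Y i @^-1` B i)).
    apply: fin_bigcap_measurable => // i _; rewrite -[_ @^-1` _]setTI.
    exact: mY.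
  by apply/seteqP; split => w /= h i; [move=> _; exact: h|exact: h].
rewrite setIT law//.
under eq_bigr do rewrite Bm.
by elim/big_ind2 : _ => // x y x' y' -> ->.
Qed.

(** The indicators are replaced by the functions [g i] one coordinate at a
    time; the integrals are required to be finite so that the constant of
    [ge0_weighted_pushforward] is a real number. *)
Lemma expectation_prod (g : 'I_d -> R -> R) (m : 'I_d -> R) :
  (forall i, measurable_fun setT (g i)) -> (forall i x, 0 <= g i x) ->
  (forall i, (\int[nu]_x (g i x)%:E = (m i)%:E)%E) ->
  (\int[P]_w (\prod_(i < d) g i (Y i w))%:E = (\prod_(i < d) m i)%:E)%E.
Proof.
suff gen k : (k <= d)%N -> forall (g : 'I_d -> R -> R) m,
    (forall i, measurable_fun setT (g i)) -> (forall i x, 0 <= g i x) ->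
    (forall i, (\int[nu]_x (g i x)%:E = (m i)%:E)%E) ->
    (forall i : 'I_d, (k <= i)%N -> exists2 B, measurable B & g i = \1_B) ->
    (\int[P]_w (\prod_(i < d) g i (Y i w))%:E = (\prod_(i < d) m i)%:E)%E.
  move=> mg g0 gm; apply: (gen d) => // i.
  by rewrite leqNgt ltn_ord.
elim: k => [_|k IH kd] {}g {}m mg g0 gm gB.
  have h (i : 'I_d) : exists B : set R, measurable B /\ g i = \1_B.
    by have [B mB ->] := gB i (leq0n _); exists B.
  have [B BP] := boolp.choice h.
  transitivity (\int[P]_w (\prod_(i < d) \1_(B i) (Y i w))%:E)%E.
    apply: eq_integral => w _; congr EFin; apply: eq_bigr => i _.
    by have [_ ->] := BP i.
  apply: expectation_prod_indic => i; first by have [] := BP i.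
  have [mB gi] := BP i; rewrite -gm gi integral_indic//.
  by rewrite setIT.
pose j := Ordinal kd.
have m0 i : 0 <= m i by rewrite -lee_fin -gm; apply: integral_ge0 => x _; rewrite lee_fin.
have mgY i : measurable_fun setT (fun w => g i (Y i w)) by exact: measurableT_comp.
transitivity (\int[P]_w ((\prod_(i < d | i != j) g i (Y i w)) * g j (Y j w))%:E)%E.
  by apply: eq_integral => w _; rewrite (bigD1 j)//= mulrC.
rewrite (@ge0_weighted_pushforward _ _ _ _ R P nu
   (fun w => \prod_(i < d | i != j) g i (Y i w)) (Y j) (\prod_(i < d | i != j) m i))//; last exact: mg.
- by rewrite gm -EFinM [in RHS](bigD1 j)//= mulrC.
- under eq_fun do rewrite -big_filter.
  exact: measurable_prod.
- by move=> w; apply: prodr_ge0 => i _.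
- exact: mY.
move=> B mB.
have nuB : nu B = (fine (nu B))%:E by rewrite fineK// fin_num_measure.
pose g' i := if i == j then \1_B else g i.
pose m' i := if i == j then fine (nu B) else m i.
have m'E : \prod_(i < d) m' i = (\prod_(i < d | i != j) m i) * fine (nu B).
  rewrite (bigD1 j)//= mulrC; congr (_ * _); last by rewrite /m' eqxx.
  by apply: eq_bigr => i /negbTE ij; rewrite /m' ij.
transitivity ((\prod_(i < d) m' i)%:E); last first.
  by rewrite m'E EFinM; congr (_ * _)%E; exact/esym/nuB.
rewrite -(IH (ltnW kd) g').
- apply: eq_integral => w _; congr EFin; rewrite [RHS](bigD1 j)//= /g' eqxx mulrC.
  by congr (_ * _); apply: eq_bigr => i /negbTE ->.
- by move=> i; rewrite /g'; case: ifP.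
- by move=> i x; rewrite /g'; case: ifP.
- move=> i; rewrite /g' /m'; case: ifP => // _.
  by rewrite integral_indic// setIT.
- move=> i ki; rewrite /g'; case: ifP => [_|/negbT ij]; first by exists B.
  apply: gB; rewrite ltn_neqAle ki andbT; apply: contra ij => /eqP ij.
  exact/eqP/val_inj.
Qed.

End ProductExpectation.

(** The half-lines generate the Borel sets of the line, and their preimages
    under a coordinate are open in the space of vectors. *)
Lemma measurable_random_vector_coord (R : realType) (disp : measure_display)
    (T : measurableType disp) (d : nat) (Y : T -> 'rV[R]_d) (i : 'I_d) :
  random_vector Y -> measurable_fun setT (fun w => Y w ord0 i).
Proof.
move=> rY; apply: (measurability _ (RGenOInfty.measurableE R)) => // _ [_ [a ->] <-].
rewrite setTI; apply: (rY [set x | x ord0 i \in `]a, +oo[]).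
apply: sub_sigma_algebra => /=.
apply: (@open_comp _ _ (fun x : 'rV[R]_d => x ord0 i) `]a, +oo[) => [x _|].
  exact: coord_continuous.
exact: interval_open.
Qed.

(** * Summation over multi-indices *)

Section Summation.
Context {R : realType}.

(** A finite set of multi-indices lies in a box, and over a box the sum of
    products is the product of the one-dimensional sums. *)
Lemma sum_prod_over_box_le (d : nat) (u : nat -> R) (M : R)
    (s : seq {ffun 'I_d -> nat}) : (forall n, 0 <= u n) ->
  (forall N, \sum_(n < N) u n <= M) -> uniq s ->
  \sum_(a <- s) \prod_(i < d) u (a i) <= M ^+ d.
Proof.
move=> u0 uM us.
pose N := \max_(a <- s) \max_(i < d) a i.
have aN a (i : 'I_d) : a \in s -> (a i < N.+1)%N.
  move=> ai; rewrite ltnS; apply: (@leq_trans (\max_(i < d) a i)).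
    exact: (@leq_bigmax_cond _ xpredT (fun i => a i)).
  by rewrite /N (big_rem a)//= leq_maxl.
pose box (a : {ffun 'I_d -> nat}) : {ffun 'I_d -> 'I_N.+1} := [ffun i => inord (a i)].
have boxK a (i : 'I_d) : a \in s -> box a i = a i :> nat.
  by move=> ai; rewrite ffunE inordK// aN.
have ubox : uniq [seq box a | a <- s].
  rewrite map_inj_in_uniq// => a b ai bi ab; apply/ffunP => i.
  by rewrite -(boxK a)// -(boxK b)// ab.
have -> : \sum_(a <- s) \prod_(i < d) u (a i) =
    \sum_(f <- [seq box a | a <- s]) \prod_(i < d) u (f i).
  rewrite big_map big_seq [RHS]big_seq; apply: eq_bigr => a ai.
  by apply: eq_bigr => i _; rewrite boxK.
rewrite big_uniq//=.
apply: (@le_trans _ _ (\sum_(f : {ffun 'I_d -> 'I_N.+1}) \prod_(i < d) u (f i))).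
  rewrite [leRHS](bigID (mem [seq box a | a <- s]))/= lerDl sumr_ge0// => f _.
  by apply: prodr_ge0 => i _; exact: u0.
rewrite -(bigA_distr_bigA (fun (i : 'I_d) (j : 'I_N.+1) => u j)).
rewrite prodr_const card_ord lerXn2r// nnegrE.
  by apply: sumr_ge0.
by apply: le_trans (uM 0%N); rewrite big_ord0.
Qed.

Lemma esum_prod_lt_pinfty (d : nat) (u : nat -> R) (C M : R) : 0 <= C ->
  (forall n, 0 <= u n) -> (forall N, \sum_(n < N) u n <= M) ->
  (\esum_(a in [set: {ffun 'I_d -> nat}]) (C * \prod_(i < d) u (a i))%:E < +oo)%E.
Proof.
move=> C0 u0 uM; apply: (@le_lt_trans _ _ (C * M ^+ d)%:E); last exact: ltry.
apply: ub_ereal_sup => _ [A [finA _] <-].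
rewrite fsbig_finite//= sumEFin lee_fin -mulr_sumr ler_wpM2l//.
by apply: sum_prod_over_box_le => //; exact: finmap.fset_uniq.
Qed.

(** Multiplication by [(1 - r)^2] telescopes the sum. *)
Lemma sum_arith_geometric_le (r : R) N : 0 <= r < 1 ->
  \sum_(n < N) n.+1%:R * r ^+ n <= ((1 - r) ^+ 2)^-1.
Proof.
move=> /andP[r0 r1].
have q0 : 0 < (1 - r) ^+ 2 by rewrite exprn_gt0// subr_gt0.
rewrite -[leRHS]mul1r ler_pdivlMr// mulrC.
have -> : (1 - r) ^+ 2 * (\sum_(n < N) n.+1%:R * r ^+ n) =
    1 - (N.+1%:R * r ^+ N - N%:R * r ^+ N.+1).
  elim: N => [|N IH]; first by rewrite big_ord0 expr0; ring.
  by rewrite big_ord_recr mulrDr IH /= !exprS -!natr1; ring.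
rewrite gerBl subr_ge0 exprS mulrCA -natr1 mulrDl mul1r.
have h : 0 <= r ^+ N by rewrite exprn_ge0.
have h2 : 0 <= N%:R * r ^+ N by rewrite mulr_ge0.
rewrite -[leLHS]addr0 lerD//.
by rewrite ler_piMl// ltW.
Qed.

(** A crude form of the Stirling upper bound. For [n > 0] the induction proves
    [n! e^n <= e n^(n+1)], whose step is [e <= (1 + 1/n)^(n+1)], in the form
    [(1 - 1/(n+1))^(n+1) <= e^(-1)]. *)
Lemma fact_expR_le n : n`!%:R * expR n%:R <= expR 1 * n.+1%:R * n%:R ^+ n :> R.
Proof.
case: n => [|n]; first by rewrite expR0 !mulr1 ltW// expR_gt1.
apply: (@le_trans _ _ (expR 1 * n.+1%:R ^+ n.+2)); last first.
  by rewrite -mulrA ler_wpM2l ?expR_ge0// exprS ler_wpM2r ?exprn_ge0// ler_nat.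
elim: n => [|n IH]; first by rewrite expr1n mulr1 mul1r.
rewrite factS natrM -[in expR _%:R]natr1 expRD.
rewrite (_ : _ * _ = n.+2%:R * expR 1 * (n.+1`!%:R * expR n.+1%:R)); last by ring.
apply: (@le_trans _ _ (n.+2%:R * expR 1 * (expR 1 * n.+1%:R ^+ n.+2))).
  by rewrite ler_wpM2l// mulr_ge0// expR_ge0.
rewrite (exprS n.+2%:R) (mulrC n.+2%:R (expR 1)) -!mulrA ler_wpM2l ?expR_ge0// ler_wpM2l//.
rewrite -ler_pdivlMl ?expR_gt0// -expRN.
have n2 : n.+2%:R != 0 :> R by rewrite pnatr_eq0.
have h : 1 - n.+2%:R^-1 <= expR (- n.+2%:R^-1) :> R by exact: expR_ge1Dx.
have -> : n.+1%:R = (1 - n.+2%:R^-1) * n.+2%:R :> R.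
  by rewrite mulrBl mulVf// mul1r -[n.+2%:R]natr1 addrK.
rewrite exprMn ler_wpM2r ?exprn_ge0//.
have -> : - 1 = (- n.+2%:R^-1) * n.+2%:R :> R by rewrite mulNr mulVf.
rewrite expRM_natr.
apply: lerXn2r => //; rewrite nnegrE ?expR_ge0//.
by rewrite subr_ge0 invf_le1 ?ler1n.
Qed.

End Summation.

(** * Comparison of the L^p norm at time s with the L^1 norm at time t *)

Section OneDimension.
Context {R : realType} (H : nat -> R -> R -> R) (HH : hermite_generating H).
Implicit Types (s t p : R) (n : nat).

(** The lower bound of [hermite_normal_L1_ge] at its optimal parameter
    [a = sqrt (n / t)]. *)
Definition hermite_L1_bound t n : R :=
  Num.sqrt (n%:R * t) ^+ n * expR (- (2^-1 * n%:R)).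

(** A bound for the quotient of the L^p norm at time [s] by
    [hermite_L1_bound t n]. *)
Definition hermite_ratio p s t n : R :=
  2 * expR 1 * (n.+1%:R * Num.sqrt ((p + 1) * s / t) ^+ n).

Lemma hermite_L1_bound_ge0 t n : 0 <= hermite_L1_bound t n.
Proof. by rewrite mulr_ge0 ?expR_ge0// exprn_ge0// sqrtr_ge0. Qed.

Lemma hermite_ratio_ge0 p s t n : 0 <= hermite_ratio p s t n.
Proof. by rewrite mulr_ge0 ?mulr_ge0 ?expR_ge0// exprn_ge0// sqrtr_ge0. Qed.

Lemma hermite_L1_ge t n : 0 < t ->
  ((hermite_L1_bound t n)%:E <=
   \int[normal_prob 0 (Num.sqrt t)]_x `|H n t x|%:E)%E.
Proof.
move=> t0; have st0 : 0 < Num.sqrt t by rewrite sqrtr_gt0.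
have tE : Num.sqrt t ^+ 2 = t by rewrite sqr_sqrtr// ltW.
have := @hermite_normal_L1_ge R H HH _ st0 (Num.sqrt (n%:R / t)) n (sqrtr_ge0 _).
rewrite tE; apply: le_trans; rewrite lee_fin le_eqVlt; apply/orP; left; apply/eqP.
rewrite /hermite_L1_bound; congr (_ ^+ n * expR (- _)).
  rewrite -{3}tE expr2 -!sqrtrM ?mulr_ge0 ?invr_ge0 ?(ltW t0)//.
  by rewrite mulrA divfK ?gt_eqF// mulrAC -mulrA -expr2 sqrtr_sqr.
by rewrite sqr_sqrtr ?divr_ge0 ?(ltW t0)// mulrA divfK// gt_eqF.
Qed.

(** The left-hand side is the L^p bound at its optimal parameter. The product
    of the three square roots involved is [n], which reduces the claim to
    [fact_expR_le]. *)
Lemma hermite_ratio_exp p s t n : 1 <= p -> 0 < s -> 0 < t -> (0 < n)%N ->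
  2 * (n`!%:R / Num.sqrt (n%:R / ((p + 1) * s)) ^+ n * expR (2^-1 * n%:R)) <=
  hermite_ratio p s t n * hermite_L1_bound t n.
Proof.
move=> p1 s0 t0 n0.
have q0 : 0 < (p + 1) * s by rewrite mulr_gt0//; lra.
have nR0 : 0 < n%:R :> R by rewrite ltr0n.
have a0 : 0 < Num.sqrt (n%:R / ((p + 1) * s)) by rewrite sqrtr_gt0 divr_gt0.
set a := Num.sqrt _ in a0 *.
have e0 : 0 < expR (2^-1 * n%:R) :> R by rewrite expR_gt0.
rewrite /hermite_ratio /hermite_L1_bound expRN.
set rho := Num.sqrt _; set b := Num.sqrt _.
have rab : rho * b * a = n%:R.
  have r0 : 0 <= (p + 1) * s / t by rewrite divr_ge0 ?ltW.
  have rb0 : 0 <= (p + 1) * s / t * (n%:R * t) by apply: mulr_ge0 => //; rewrite mulr_ge0// ltW.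
  rewrite /rho /b /a -(sqrtrM _ r0) -(sqrtrM _ rb0).
  rewrite (_ : _ * _ = n%:R ^+ 2); first by rewrite sqrtr_sqr ger0_norm.
  by field; rewrite !gt_eqF//; lra.
have e2 : expR (2^-1 * n%:R) * expR (2^-1 * n%:R) = expR n%:R :> R.
  by rewrite -expRD; congr expR; field.
have key := @fact_expR_le R n.
rewrite -!mulrA ler_wpM2l//.
rewrite -(ler_pM2r (exprn_gt0 n a0)) -(ler_pM2r e0).
have -> : n`!%:R * (a ^- n * expR (2^-1 * n%:R)) * a ^+ n * expR (2^-1 * n%:R)
   = n`!%:R * expR n%:R.
  by rewrite -e2; field; rewrite gt_eqF// exprn_gt0.
apply: le_trans key _.
rewrite (_ : n%:R ^+ n = rho ^+ n * b ^+ n * a ^+ n); last by rewrite -!exprMn rab.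
by rewrite le_eqVlt; apply/orP; left; apply/eqP; field; rewrite gt_eqF.
Qed.

(** For [n > 0] the parameter [a = sqrt (n / ((p + 1) s))] balances the two
    Gaussian factors; [n = 0], where it would vanish, is immediate. *)
Lemma hermite_Lp_le p s t n : 1 <= p -> 0 < s -> 0 < t ->
  (\int[normal_prob 0 (Num.sqrt s)]_x (`|H n s x| `^ p)%:E <=
   ((hermite_ratio p s t n * hermite_L1_bound t n) `^ p)%:E)%E.
Proof.
move=> p1 s0 t0; have p0 : 0 < p by lra.
have ss0 : 0 < Num.sqrt s by rewrite sqrtr_gt0.
have sE : Num.sqrt s ^+ 2 = s by rewrite sqr_sqrtr// ltW.
case: (posnP n) => [->|n0].
  under eq_integral do rewrite (hermite0 HH) normr1 powR1.
  rewrite integral_cst// mul1e [X in (X <= _)%E](_ : _ = 1%E); last exact: probability_setT.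
  have e1 : 1 = 1 `^ p :> R by rewrite powR1.
  rewrite lee_fin [leLHS]e1; apply: ge0_ler_powR; rewrite ?nnegrE ?(ltW p0)//.
    by rewrite mulr_ge0 ?hermite_ratio_ge0 ?hermite_L1_bound_ge0.
  rewrite /hermite_ratio /hermite_L1_bound !expr0 mulr0 oppr0 expR0 !mulr1.
  by have := @expR_gt1 R 1; rewrite ltr01 => h; lra.
have q0 : 0 < (p + 1) * s by rewrite mulr_gt0//; lra.
pose a := Num.sqrt (n%:R / ((p + 1) * s)).
have a0 : 0 < a by rewrite sqrtr_gt0 divr_gt0// ltr0n.
have aE : a ^+ 2 * s = n%:R / (p + 1).
  rewrite sqr_sqrtr ?divr_ge0 ?(ltW q0)//.
  by field; rewrite !gt_eqF//; lra.
have := @hermite_normal_Lp_le R H HH _ ss0 p a n p0 a0; rewrite sE => /le_trans; apply.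
rewrite lee_fin.
set c := n`!%:R / a ^+ n.
have c0 : 0 <= c by rewrite divr_ge0// exprn_ge0// ltW.
have key := hermite_ratio_exp p1 s0 t0 n0; rewrite -/a -/c in key.
move: c c0 key => c c0 key.
apply: (@le_trans _ _ ((2 * (c * expR (2^-1 * n%:R))) `^ p)); last first.
  apply: ge0_ler_powR; rewrite ?nnegrE ?(ltW p0)//.
  - by rewrite mulr_ge0// mulr_ge0// expR_ge0.
  - by rewrite mulr_ge0 ?hermite_ratio_ge0 ?hermite_L1_bound_ge0.
have -> : expR (2^-1 * (p * a) ^+ 2 * s) = expR (2^-1 * (p * (a ^+ 2 * s))) `^ p.
  by rewrite -expRM; congr expR; ring.
rewrite -mulrA -powRM ?mulr_ge0 ?expR_ge0// -(mulrA c) -expRD.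
rewrite [leRHS]powRM ?mulr_ge0 ?expR_ge0//.
have -> : 2^-1 * a ^+ 2 * s + 2^-1 * (p * (a ^+ 2 * s)) = 2^-1 * n%:R.
  by rewrite -mulrA aE; field; rewrite gt_eqF//; lra.
rewrite ler_wpM2r ?powR_ge0// -[leLHS]powRr1//.
by rewrite ler_powR//; lra.
Qed.

Lemma hermite_at0 n : H n 0 0 = (n == 0%N)%:R.
Proof.
elim/two_step_ind: n => [||n _ _]; first by rewrite (hermite0 HH).
  by rewrite (hermite1 HH).
by rewrite (hermiteSS HH) !mulr0 !mul0r subr0.
Qed.

(** The time [s = 0] is degenerate, as [normal_prob] with standard deviation
    [0] is not a Dirac mass; there the ratio vanishes for [n > 0], like
    [H_n(0, 0)] itself. *)
Lemma hermite_at0_le p t n : `|H n 0 0| <= hermite_ratio p 0 t n * hermite_L1_bound t n.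
Proof.
rewrite hermite_at0 /hermite_ratio /hermite_L1_bound mulr0 mul0r sqrtr0.
case: n => [|n] /=; last by rewrite normr0 !exprS !(mul0r, mulr0).
rewrite normr1 !expr0 mulr0 oppr0 expR0 !mulr1.
by have := @expR_gt1 R 1; rewrite ltr01 => h; lra.
Qed.

End OneDimension.

(** * Hermite polynomials of Brownian motion *)

Lemma powR_prod (R : realType) (I : Type) (r : seq I) (F : I -> R) (p : R) :
  (forall i, 0 <= F i) -> (\prod_(i <- r) F i) `^ p = \prod_(i <- r) F i `^ p.
Proof.
move=> F0.
suff [] : 0 <= \prod_(i <- r) F i /\ (\prod_(i <- r) F i) `^ p = \prod_(i <- r) F i `^ p by [].
elim/big_rec2 : _ => [|i x y _ [y0 <-]]; first by rewrite powR1.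
by rewrite powRM// mulr_ge0.
Qed.

Section BrownianMotion.
Context {R : realType} {disp : measure_display} {Omega : measurableType disp}.
Context {P : probability Omega R} {d : nat} {X : R -> Omega -> 'rV[R]_d}.
Context (X_bm : brownian_motion P X).
Context {H : nat -> R -> R -> R} (HH : hermite_generating H).
Implicit Types (s t : R) (a : {ffun 'I_d -> nat}).

Lemma measurable_bm_coord s i : 0 <= s -> measurable_fun setT (fun w => X s w ord0 i).
Proof. by move=> s0; apply: measurable_random_vector_coord; exact: (bm_measurable X_bm). Qed.

Lemma measurable_hermite_bm a s : 0 <= s ->
  measurable_fun setT (fun w => hermite_multi H a s (X s w)).
Proof.
move=> s0; apply: measurable_prod => i _.
apply: measurableT_comp; [exact: measurable_hermite|exact: measurable_bm_coord].
Qed.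

(** The Gaussian law is given for the increment [X s - X 0], which is almost
    surely [X s]. *)
Lemma bm_expectation_prod s (g : 'I_d -> R -> R) (m : 'I_d -> R) : 0 < s ->
  (forall i, measurable_fun setT (g i)) -> (forall i x, 0 <= g i x) ->
  (forall i, (\int[normal_prob 0 (Num.sqrt s)]_x (g i x)%:E = (m i)%:E)%E) ->
  (\int[P]_w (\prod_(i < d) g i (X s w ord0 i))%:E = (\prod_(i < d) m i)%:E)%E.
Proof.
move=> s0 mg g0 gm; have s0' := ltW s0.
pose Y (i : 'I_d) w := X s w ord0 i - X 0 w ord0 i.
have mY i : measurable_fun setT (Y i).
  by apply: measurable_funB; exact: measurable_bm_coord.
rewrite -(@expectation_prod _ _ _ P d Y (normal_prob 0 (Num.sqrt s) : probability _ R) _ _ g m)//; last first.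
  move=> B mB; have := bm_gaussian X_bm (lexx 0) s0 mB; rewrite subr0 => <-.
  by congr (P _); apply/seteqP; split => w /= h i; have := h i; rewrite /Y !mxE.
apply: ge0_ae_eq_integral => //.
- apply/measurable_EFinP; apply: measurable_prod => i _.
  by apply: measurableT_comp => //; exact: measurable_bm_coord.
- apply/measurable_EFinP; apply: measurable_prod => i _.
  exact: measurableT_comp.
- by move=> w _; rewrite lee_fin prodr_ge0.
- by move=> w _; rewrite lee_fin prodr_ge0.
have := bm_start X_bm; apply: filterS => w Xw _.
by rewrite /Y Xw; under [in RHS]eq_bigr do rewrite mxE subr0.
Qed.

Lemma hermite_bm_moment a s (p : R) : 0 < s -> 1 <= p ->
  exists m : 'I_d -> R,
    (forall i, (\int[normal_prob 0 (Num.sqrt s)]_x (`|H (a i) s x| `^ p)%:E = (m i)%:E)%E) /\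
    (\int[P]_w (`|hermite_multi H a s (X s w)| `^ p)%:E = (\prod_(i < d) m i)%:E)%E.
Proof.
move=> s0 p1.
pose I i := (\int[normal_prob 0 (Num.sqrt s)]_x (`|H (a i) s x| `^ p)%:E)%E.
have I0 i : (0 <= I i)%E by apply: integral_ge0 => x _; rewrite lee_fin powR_ge0.
have Ioo i : (I i < +oo)%E.
  by apply: le_lt_trans (hermite_Lp_le HH (a i) p1 s0 s0) _; exact: ltry.
exists (fun i => fine (I i)).
have mE i : I i = (fine (I i))%:E by rewrite fineK// ge0_fin_numE.
split=> //.
rewrite -(@bm_expectation_prod s (fun i x => `|H (a i) s x| `^ p)) //.
- apply: eq_integral => w _; congr EFin.
  by rewrite /hermite_multi normr_prod powR_prod.
- move=> i; apply: (measurableT_comp (measurable_powR p)).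
  by apply: measurableT_comp => //; exact: measurable_hermite.
Qed.

Lemma hermite_bm_L1_ge a t : 0 < t ->
  ((\prod_(i < d) hermite_L1_bound t (a i))%:E <=
   \int[P]_w `|hermite_multi H a t (X t w)|%:E)%E.
Proof.
move=> t0; have [m [mE hE]] := hermite_bm_moment a t0 (lexx 1).
under eq_integral do rewrite -[`|_|]powRr1//.
rewrite hE lee_fin; apply: ler_prod => i _; rewrite hermite_L1_bound_ge0/=.
rewrite -lee_fin -mE; under eq_integral do rewrite powRr1//.
exact: hermite_L1_ge.
Qed.

(** For [s > 0] the moment factorizes over the coordinates; for [s = 0] the
    integrand is almost surely constant. *)
Lemma hermite_bm_Lp_le a s t (p : R) : 0 <= s -> 0 < t -> 1 <= p ->
  (\int[P]_w (`|hermite_multi H a s (X s w)| `^ p)%:E <=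
   ((\prod_(i < d) (hermite_ratio p s t (a i) * hermite_L1_bound t (a i))) `^ p)%:E)%E.
Proof.
move=> s0 t0 p1.
have rL0 n : 0 <= hermite_ratio p s t n * hermite_L1_bound t n.
  by rewrite mulr_ge0 ?hermite_ratio_ge0 ?hermite_L1_bound_ge0.
have [s_eq0|s_neq0] := eqVneq s 0; last first.
  have s_gt0 : 0 < s by rewrite lt_neqAle eq_sym s_neq0.
  have [m [mE ->]] := hermite_bm_moment a s_gt0 p1.
  rewrite lee_fin powR_prod//; apply: ler_prod => i _.
  by rewrite -!lee_fin -mE hermite_Lp_le// andbT integral_ge0// => x _; rewrite lee_fin powR_ge0.
rewrite s_eq0 in rL0 *.
have -> : (\int[P]_w (`|hermite_multi H a 0 (X 0 w)| `^ p)%:E =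
    \int[P]_w cst ((\prod_(i < d) `|H (a i) 0 0|) `^ p)%:E w)%E.
  apply: ge0_ae_eq_integral => //.
  - apply/measurable_EFinP; apply: (measurableT_comp (measurable_powR p)).
    by apply: measurableT_comp => //; exact: measurable_hermite_bm.
  - by move=> w _; rewrite lee_fin powR_ge0.
  have := bm_start X_bm; apply: filterS => w Xw _ /=.
  rewrite /hermite_multi normr_prod Xw.
  by under eq_bigr do rewrite mxE.
rewrite integral_cst// [X in (_ * X)%E](_ : _ = 1%E) ?mule1; last exact: probability_setT.
rewrite lee_fin; apply: ge0_ler_powR; rewrite ?nnegrE ?prodr_ge0//; first lra.
by apply: ler_prod => i _; rewrite normr_ge0 hermite_at0_le.
Qed.

End BrownianMotion.

Lemma Lnorm_le_of_moment_le (d : measure_display) (T : measurableType d) (R : realType)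
    (mu : {measure set T -> \bar R}) (f : T -> R) (p c : R) : 0 < p -> 0 <= c ->
  (\int[mu]_w (`|f w| `^ p)%:E <= (c `^ p)%:E)%E -> ('N[mu]_p%:E[EFin \o f] <= c%:E)%E.
Proof.
move=> p0 c0 h; rewrite unlock.
have pV0 : 0 <= p^-1 by rewrite invr_ge0 ltW.
apply: (@le_trans _ _ ((c `^ p)%:E `^ p^-1)%E).
  apply: gt0_ler_poweR => //.
  - rewrite in_itv/= leey andbT; apply: integral_ge0 => x _.
    by rewrite lee_fin powR_ge0.
  - by rewrite in_itv/= leey andbT lee_fin powR_ge0.
by rewrite poweR_EFin -powRrM mulfV ?gt_eqF// powRr1.
Qed.

Theorem proposition3p6 (R : realType) (disp : measure_display)
    (Omega : measurableType disp) (P : probability Omega R)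
    (P_complete : measure_is_complete P)
    (d : nat) (d_gt0 : (0 < d)%N)
    (X : R -> Omega -> 'rV[R]_d) (X_bm : brownian_motion P X)
    (H : nat -> R -> R -> R) (H_hermite : hermite_generating H)
    (t : R) (t_ge0 : 0 <= t) (b : {ffun 'I_d -> nat} -> R)
    (b_bounded : bounded_in_Lp P 1
       (fun (a : {ffun 'I_d -> nat}) w => b a * hermite_multi H a t (X t w))) :
  forall p : R, 1 < p ->
  forall s : R, 0 <= s -> s < t / (d%:R ^+ 2 * expR p) ->
    converges_absolutely_in_Lp P p
      (fun (a : {ffun 'I_d -> nat}) w => b a * hermite_multi H a s (X s w)).
Proof.
move=> p p1 s s0 st.
have d1 : 1 <= d%:R :> R by rewrite ler1n.
have ep : p + 1 <= expR p by rewrite addrC expR_ge1Dx.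
have dep : p + 1 <= d%:R ^+ 2 * expR p.
  by apply: (le_trans ep); rewrite ler_peMl ?expR_ge0// exprn_ege1.
have dep0 : 0 < d%:R ^+ 2 * expR p by lra.
have st' : s * (d%:R ^+ 2 * expR p) < t by rewrite -ltr_pdivlMr.
have t0 : 0 < t by apply: le_lt_trans st'; rewrite mulr_ge0// ltW.
have pst : (p + 1) * s < t.
  by apply: le_lt_trans st'; rewrite mulrC ler_wpM2l.
pose u := hermite_ratio p s t.
have u0 n : 0 <= u n by exact: hermite_ratio_ge0.
pose rho := Num.sqrt ((p + 1) * s / t).
have rho01 : 0 <= rho < 1.
  rewrite sqrtr_ge0 -sqrtr1 ltr_sqrt ?ltr01// ltr_pdivrMr// mul1r pst//.
have uM N : \sum_(n < N) u n <= 2 * expR 1 * ((1 - rho) ^+ 2)^-1.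
  rewrite /u /hermite_ratio -mulr_sumr ler_wpM2l ?mulr_ge0 ?expR_ge0//.
  exact: sum_arith_geometric_le.
have [_ [C bC]] := b_bounded.
have bLC a : `|b a| * \prod_(i < d) hermite_L1_bound t (a i) <= C.
  rewrite -lee_fin; apply: le_trans (bC a); rewrite Lnorm1.
  under eq_integral do rewrite /= normrM EFinM.
  rewrite ge0_integralZl//; last first.
    apply/measurable_EFinP; apply: measurableT_comp => //.
    exact: (measurable_hermite_bm X_bm H_hermite).
  by rewrite EFinM lee_wpmul2l// hermite_bm_L1_ge.
have C0 : 0 <= C.
  apply: le_trans (bLC [ffun=> 0%N]); rewrite mulr_ge0// prodr_ge0// => i _.
  exact: hermite_L1_bound_ge0.
have p0 : 0 < p by lra.
have mh a : measurable_fun setT (fun w => b a * hermite_multi H a s (X s w)).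
  by apply: measurable_funM => //; exact: (measurable_hermite_bm X_bm H_hermite).
have NV a : ('N[P]_p%:E[EFin \o (fun w => (b a * hermite_multi H a s (X s w))%R)] <=
    (C * \prod_(i < d) u (a i))%:E)%E.
  apply: Lnorm_le_of_moment_le => //; first by rewrite mulr_ge0// prodr_ge0.
  under eq_integral do rewrite normrM powRM// EFinM.
  rewrite ge0_integralZl//; last first.
    apply/measurable_EFinP; apply: (measurableT_comp (measurable_powR p)).
    apply: measurableT_comp => //; exact: (measurable_hermite_bm X_bm H_hermite).
  apply: (@le_trans _ _ ((`|b a| `^ p)%:E * ((\prod_(i < d)
     (hermite_ratio p s t (a i) * hermite_L1_bound t (a i))) `^ p)%:E)%E).
    rewrite lee_wpmul2l ?lee_fin ?powR_ge0// hermite_bm_Lp_le//; exact: ltW.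
  have L0 : 0 <= \prod_(i < d) hermite_L1_bound t (a i).
    by rewrite prodr_ge0// => i _; exact: hermite_L1_bound_ge0.
  have U0 : 0 <= \prod_(i < d) u (a i) by rewrite prodr_ge0.
  rewrite big_split/= -EFinM lee_fin -powRM// ?mulr_ge0//.
  apply: ge0_ler_powR; rewrite ?nnegrE ?(ltW p0)// ?mulr_ge0//.
  by rewrite mulrCA mulrC ler_wpM2r.
split.
  move=> a; rewrite inE/=; apply/andP; split; rewrite inE/=.
    exact: mh.
  exact: le_lt_trans (NV a) (ltry _).
apply: le_lt_trans (esum_prod_lt_pinfty d C0 u0 uM).
by apply: le_esum => a _; exact: NV.
Qed.
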